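(* Let $\Omega$ be an eventually outward finitely branched tree quiver and let $\mathcal{C}$ be the set of (nonempty) connected full subquivers of $\Omega$. The relation $>$ on $\mathcal{C}$ generated by reductions and enhancements is a well-founded strict partial order.
   Context: A quiver $\Omega$ consists of a set $\Omega_0$ of vertices, a set $\Omega_1$ of arrows, and source and target functions $s,t:\Omega_1\to\Omega_0$. It is a tree if every two vertices are joined by at most one arrow (in some direction), there are no loops, and the underlying undirected graph is a tree. A walk is a map $w$ from a finite or infinite interval of $\mathbb{Z}$ to $\Omega_0$ such that $w_i$ and $w_{i+1}$ are the two ends of an arrow $e$ whenever $i,i+1$ are in the interval; $e$ is oriented consistently if $s(e)=w_i,\ t(e)=w_{i+1}$, and inconsistently if $s(e)=w_{i+1},\ t(e)=w_i$. A journey is a walk whose interval has a minimal element; a walk is injective if the map is. $\Omega$ is finitely branched if it is a union of finitely many injective walks (equivalently, for any vertex $x$, a union of finitely many injective journeys starting at $x$). $\Omega$ is eventually outward if every injective journey contains at most finitely many arrows oriented inconsistently. Removing an arrow $e$ splits $\Omega$ into two connected subquivers: the one containing $t(e)$ is in front of $e$, and the one containing $s(e)$ is behind $e$. For $\alpha,\beta\in\mathcal{C}$: $\beta$ is a reduction of $\alpha$ if there is an arrow $e$ in $\alpha$ such that $\beta$ is the portion of $\alpha$ behind $e$; $\beta$ is an enhancement of $\alpha$ if there is an arrow $e$ in $\beta$ such that $\alpha$ is the portion of $\beta$ in front of $e$. Write $\alpha>\beta$ if one can get from $\alpha$ to $\beta$ by a finite sequence of one or more such moves (each term a reduction or enhancement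 of the previous one). Well-founded means there is no infinite chain $\alpha_1>\alpha_2>\cdots$. *)

(* Defs.v *)
From mathcomp Require Import all_boot all_order all_algebra.
From mathcomp Require Import classical_sets cardinality.
From Stdlib Require Import Relation_Operators RelationClasses.

Set Implicit Arguments.
Unset Strict Implicit.
Unset Printing Implicit Defensive.

Local Open Scope classical_set_scope.
Local Open Scope ring_scope.

Record quiver := Quiver {
  vertex : Type;
  arrow : Type;
  src : arrow -> vertex;
  tgt : arrow -> vertex }.

Section Quiver.
Variable Q : quiver.
Implicit Types (x y : vertex Q) (e f : arrow Q).

Definition joins e x y : Prop :=
  (src e = x /\ tgt e = y) \/ (src e = y /\ tgt e = x).

Definition adjacent x y : Prop := exists e, joins e x y.

(* [x] and [y] are joined by a path all of whose arrows lie in [E]. *)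
Definition linked (E : set (arrow Q)) : vertex Q -> vertex Q -> Prop :=
  clos_refl_trans (vertex Q) (fun x y => exists2 e, E e & joins e x y).

Definition cycle_of_length n (c : 'I_n -> vertex Q) : Prop :=
  [/\ (2 < n)%N, injective c & forall i, adjacent (c i) (c (ordS i))].

Definition is_tree : Prop :=
  [/\ forall e f x y, joins e x y -> joins f x y -> e = f,
      forall e, src e <> tgt e,
      forall x y, linked [set: arrow Q] x y
    & forall n (c : 'I_n -> vertex Q), ~ cycle_of_length c].

(* A walk is a map defined on [walk_dom] only: [walk_map] is total for
   convenience, and its values outside [walk_dom] are never used. *)
Record walk := Walk {
  walk_dom : interval int;
  walk_map : int -> vertex Q;
  walk_step : forall i : int, i \in walk_dom -> i + 1 \in walk_dom ->
    adjacent (walk_map i) (walk_map (i + 1)) }.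

Definition injective_walk (w : walk) : Prop :=
  {in walk_dom w &, injective (walk_map w)}.

Definition journey (w : walk) : Prop :=
  exists2 m, m \in walk_dom w & forall i, i \in walk_dom w -> m <= i.

Definition walk_vertices (w : walk) : set (vertex Q) :=
  [set x | exists2 i, i \in walk_dom w & walk_map w i = x].

Definition walk_arrows (w : walk) : set (arrow Q) :=
  [set e | exists i, [/\ i \in walk_dom w, i + 1 \in walk_dom w
                       & joins e (walk_map w i) (walk_map w (i + 1))]].

Definition inconsistent_arrows (w : walk) : set (arrow Q) :=
  [set e | exists i, [/\ i \in walk_dom w, i + 1 \in walk_dom w,
                         src e = walk_map w (i + 1) & tgt e = walk_map w i]].

Definition finitely_branched : Prop :=
  exists (n : nat) (w : 'I_n -> walk),
    [/\ forall k, injective_walk (w k),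
        forall x, exists k, walk_vertices (w k) x
      & forall e, exists k, walk_arrows (w k) e].

Definition eventually_outward : Prop :=
  forall w : walk, journey w -> injective_walk w ->
    finite_set (inconsistent_arrows w).

(* A full subquiver is encoded by its set of vertices; its arrows are all the
   arrows of [Q] with both ends in that set. *)
Definition arrows_in (X : set (vertex Q)) : set (arrow Q) :=
  [set e | X (src e) /\ X (tgt e)].

Record connected_full_subquiver := ConnectedFullSubquiver {
  sub_vertices : set (vertex Q);
  sub_nonempty : sub_vertices !=set0;
  sub_connected : forall x y, sub_vertices x -> sub_vertices y ->
    linked (arrows_in sub_vertices) x y }.

Implicit Types a b : connected_full_subquiver.

Definition in_front e : set (vertex Q) := [set x | linked [set~ e] (tgt e) x].

Definition behind e : set (vertex Q) := [set x | linked [set~ e] (src e) x].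

Definition reduction a b : Prop :=
  exists2 e, arrows_in (sub_vertices a) e
    & sub_vertices b = sub_vertices a `&` behind e.

Definition enhancement a b : Prop :=
  exists2 e, arrows_in (sub_vertices b) e
    & sub_vertices a = sub_vertices b `&` in_front e.

(* [reduction a b], [enhancement a b] and [gt_sub a b] all go from [a] to [b]:
   [b] is a reduction (resp. an enhancement) of [a], resp. a > b. *)
Definition gt_sub : connected_full_subquiver -> connected_full_subquiver -> Prop :=
  clos_trans connected_full_subquiver
    (fun a b => reduction a b \/ enhancement a b).

End Quiver.

(* [r a b] reads a > b. *)
Definition no_infinite_chain (T : Type) (r : T -> T -> Prop) : Prop :=
  ~ exists u : nat -> T, forall n, r (u n) (u n.+1).

(* Main.v *)
Require Import Defs.
From Stdlib Require Import RelationClasses Relation_Operators Operators_Properties.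
From mathcomp Require Import all_boot all_order all_algebra.
From mathcomp Require Import boolp classical_sets cardinality.
From mathcomp Require Import zify.

Set Implicit Arguments.
Unset Strict Implicit.
Unset Printing Implicit Defensive.

Import Order.TTheory GRing.Theory Num.Theory.
Local Open Scope classical_set_scope.

(** The idea is that a vertex enters a decreasing sequence of subquivers at most
    once, and once it has left it never comes back.

    Let [x] be a vertex outside a connected full subquiver [a].  Exactly one
    arrow with a single end in [a] separates [a] from [x]; it points either away
    from [a], towards [x] ([x] is then blocked in front, [blocked true]), or
    towards [a], away from [x] ([blocked false]).  In the first case no move can
    ever add [x]: an enhancement goes through an arrow pointing into the
    subquiver, hence leaves the separating arrow alone, while a reduction either
    leaves it alone or replaces it by the arrow of the reduction, which again
    points towards [x] ([cut_blocked], [uncut_blocked]).  Reversing arrows and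
    time, being blocked behind is inherited by all earlier subquivers.

    A reduction at [e] blocks everything in front of [e], for ever.  So if a
    reduction at [e] precedes a reduction at [f], then [tgt f] is not in front
    of [e].  Dually an enhancement at [f] can only start from a subquiver for
    which everything behind [f] is blocked behind, so if an enhancement at [e]
    precedes one at [f], then [src e] is not behind [f].

    On the other hand, in an infinite sequence of arrows there are always an
    earlier [e] and a later [f] that are equal, or such that [f] is in front of
    [e] and [e] is behind [f] ([faces_pair]).  By finite branching, infinitely many of the arrows lie on
    one injective walk.  If none is repeated, infinitely many lie on a ray of
    it, and all but finitely many of these point outward; it remains to take
    one of them and a later one further out.  An infinite chain contains
    infinitely many reductions or infinitely many enhancements, and is thus
    impossible.
    Irreflexivity follows, since [a > a] yields a constant infinite chain. *)

(** * Infinite sets of natural numbers, intervals of integers *)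

Lemma infinite_nat_gt (S : set nat) (N : nat) :
  infinite_set S -> exists2 k, S k & N < k.
Proof.
move=> iS; have /infinite_setN0[k [Sk]] := infinite_setD iS (finite_II N.+1).
by rewrite /= => /negP; rewrite -leqNgt; exists k.
Qed.

Lemma infinite_fiber (T : Type) (S : set nat) (B : set T) (f : nat -> T) :
  infinite_set S -> finite_set B -> (forall k, S k -> B (f k)) ->
  exists2 y, B y & infinite_set [set k | S k /\ f k = y].
Proof.
move=> iS fB SB; apply/not_exists2P => H; apply: iS.
apply: (sub_finite_set (B := \bigcup_(y in B) [set k | S k /\ f k = y])).
  by move=> k Sk; exists (f k) => //; apply: SB.
apply: bigcup_finite => // y By; apply: contrapT => i; by case: (H y).
Qed.

Lemma infinite_pigeonhole (T : Type) (S : set nat) (B : set T) (f : nat -> T) :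
  infinite_set S -> finite_set B -> (forall k, S k -> B (f k)) ->
  exists m n, [/\ S m, S n, m < n & f m = f n].
Proof.
move=> iS fB SB; have [y _ iF] := infinite_fiber iS fB SB.
have [m [Sm fm] _] := infinite_nat_gt 0 iF.
have [n [Sn fn] mn] := infinite_nat_gt m iF.
by exists m, n; split=> //; rewrite fm fn.
Qed.

(** The position [p k] of an arrow on a ray is either taken twice, or unbounded;
    in the second case, any given arrow is followed by one that is both later
    in time and further out. *)
Lemma infinite_repeat_or_gt (S : set nat) (p : nat -> nat) :
  infinite_set S ->
  (exists m n, [/\ S m, S n, m < n & p m = p n]) \/
  (forall N, exists k, [/\ S k, N < k & N < p k]).
Proof.
move=> iS; have [?|nrep] := pselect (exists m n, [/\ S m, S n, m < n & p m = p n]).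
  by left.
right=> N; apply: contrapT => H; apply: nrep.
have iS' := infinite_setD iS (finite_II N.+1).
have [|m [n [[Sm _] [Sn _] mn pmn]]] :=
    @infinite_pigeonhole _ _ `I_N.+1 p iS' (finite_II _).
  move=> k [Sk /= kN]; rewrite ltnS leqNgt; apply/negP => Npk; apply: H.
  by exists k; split=> //; move/negP: kN; rewrite -leqNgt.
by exists m, n.
Qed.

Lemma itv_convex (I : interval int) (i j k : int) :
  i \in I -> k \in I -> (i <= j <= k)%R -> j \in I.
Proof.
case: I => l r; rewrite !itv_boundlr => /andP[li _] /andP[_ kr] /andP[ij jk].
apply/andP; split; first by apply: le_trans li _; rewrite bnd_simp.
by apply: le_trans kr; rewrite bnd_simp.
Qed.

(** * The two halves of a tree at an arrow *)

Lemma joinsC (Q : quiver) (e : arrow Q) x y : joins e x y -> joins e y x.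
Proof. by case; [right | left]. Qed.

Lemma linked_sym (Q : quiver) (E : set (arrow Q)) x y :
  linked E x y -> linked E y x.
Proof.
elim=> [a b [e Ee eab]|a|a b c _ ba _ cb].
- by apply: rt_step; exists e => //; apply: joinsC.
- exact: rt_refl.
- exact: rt_trans cb ba.
Qed.

Lemma linked_sub (Q : quiver) (E F : set (arrow Q)) x y :
  E `<=` F -> linked E x y -> linked F x y.
Proof.
move=> EF; elim=> [a b [e Ee eab]|a|a b c _ ab _ bc].
- by apply: rt_step; exists e => //; apply: EF.
- exact: rt_refl.
- exact: rt_trans ab bc.
Qed.

Definition arrow_end (Q : quiver) (b : bool) (e : arrow Q) : vertex Q :=
  if b then tgt e else src e.

(** The boolean selects [in_front] ([true]) or [behind] ([false]).  Reversing all
    arrows of the quiver negates it and turns reductions into reversed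
    enhancements, so that what is proved for every boolean covers both. *)
Definition half (Q : quiver) (b : bool) (e : arrow Q) : set (vertex Q) :=
  [set x | linked [set~ e] (arrow_end b e) x].

Lemma half_end (Q : quiver) b (e : arrow Q) : half b e (arrow_end b e).
Proof. exact: rt_refl. Qed.

Lemma half_step (Q : quiver) b (e f : arrow Q) x y :
  f <> e -> joins f x y -> half b e x -> half b e y.
Proof. by move=> fe fxy hx; apply: rt_trans hx _; apply: rt_step; exists f. Qed.

(** A simple path from one end of [e] to the other that avoids [e] would close
    up with [e] to a cycle; it has at least three vertices because [e] is neither
    a loop nor parallel to another arrow. *)
Lemma tree_cut (Q : quiver) (e : arrow Q) :
  is_tree Q -> ~ linked [set~ e] (tgt e) (src e).
Proof.
case=> uniqT noloop _ acyc lnk.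
pose V : eqType := {classic vertex Q}.
pose r : rel V := fun x y => `[< exists2 f, f <> e & @joins Q f x y >].
have [p rp lp] : exists2 p : seq V, path r (tgt e) p & last (tgt e : V) p = src e.
  elim: (clos_rt_rt1n _ _ _ _ lnk) => {lnk} [x|x y z [f fe fxy] _ [p rp lp]].
    by exists [::].
  by exists (y :: p) => //=; rewrite rp andbT; apply/asboolP; exists f.
case: (shortenP rp) lp => {rp}p rp up _ lp {lnk}.
pose s : seq V := (tgt e : V) :: p.
have szs : size s = (size p).+1 by [].
apply: (acyc (size s) (fun i => nth (tgt e : V) s i)); split.
- rewrite szs; case: p rp lp {s szs up} => [|y [|z p]] //=.
    by move=> _ /esym/noloop.
  rewrite andbT => /asboolP[f fe fxy] ysrc; case: fe.
  by apply: (uniqT _ _ _ _ fxy); right; rewrite ysrc.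
- move=> i j ij; apply/val_inj/eqP.
  by rewrite -(nth_uniq (tgt e : V) (ltn_ord i) (ltn_ord j) up); apply/eqP.
- move=> i; have : i < (size p).+1 := ltn_ord i; rewrite ltnS leq_eqVlt => /orP[/eqP ip|ip].
    exists e; left; split; last by rewrite /= ip modnn.
    by rewrite ip -lp; apply/esym/(nth_last (tgt e : V) s).
  have /asboolP[f _ fxy] := pathP (tgt e : V) rp i ip.
  by exists f; rewrite /= modn_small.
Qed.

Lemma half_disjoint (Q : quiver) b (e : arrow Q) x :
  is_tree Q -> half b e x -> ~ half (~~ b) e x.
Proof.
move=> hT hx hx'; apply: (tree_cut (e := e) hT); case: b hx hx' => hx hx'.
  exact: rt_trans hx (linked_sym hx').
exact: rt_trans hx' (linked_sym hx).
Qed.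

(** Along a path from an end of [e], the half can change only where the path
    runs through [e], and there the new vertex is an end of [e]. *)
Lemma half_total (Q : quiver) b (e : arrow Q) x :
  is_tree Q -> half b e x \/ half (~~ b) e x.
Proof.
case=> _ _ conn _.
elim: (clos_rt_rtn1 _ _ _ _ (conn (arrow_end b e) x)) => [|y z [f _ fyz] _ IH].
  by left; apply: half_end.
have [fe|fe] := pselect (f = e); last first.
  by case: IH => hy; [left | right]; apply: half_step fyz hy.
subst f; have [->|->] : z = src e \/ z = tgt e by case: fyz => [[_ ->]|[-> _]]; auto.
  by case: b {IH}; [right | left]; apply: half_end.
by case: b {IH}; [left | right]; apply: half_end.
Qed.

Lemma arrow_ends_joins (Q : quiver) b (e : arrow Q) :
  joins e (arrow_end b e) (arrow_end (~~ b) e).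
Proof. by case: b; [right | left]. Qed.

(** A path that starts in [half b g] and avoids [g] stays in that half, whereas
    using [h] would take it through [src h]. *)
Lemma half_linked_avoid (Q : quiver) b (g h : arrow Q) x :
  ~ half b g (src h) -> half b g x -> linked [set~ h] (arrow_end b g) x.
Proof.
move=> gh; have gh' y z : half b g y -> half b g z -> joins h y z -> False.
  by move=> gy gz [[hy _]|[hz _]]; apply: gh; [rewrite hy | rewrite hz].
move=> gx; elim: (clos_rt_rtn1 _ _ _ _ gx) => {gx} [|y z [f fg fyz] gy IH].
  exact: rt_refl.
apply: rt_trans IH _; apply: rt_step; exists f => //= fh; subst f.
have {}gy : half b g y by apply: clos_rtn1_rt.
exact: gh' gy (half_step fg fyz gy) fyz.
Qed.

(** * Vertices lost for good *)

(** The ends of [g] are required to be on either side of the border of [X]: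
    for an arbitrary arrow [g] between [X] and [x], an enhancement could cross
    [g] and reach [x]. *)
Definition blocked (Q : quiver) (b : bool) (X : set (vertex Q)) (x : vertex Q) :=
  exists g, [/\ X (arrow_end (~~ b) g), ~ X (arrow_end b g) & half b g x].

(** A reduction at [e] from [X] to [Y] when [b] is [true], an enhancement at [e]
    from [Y] to [X] when [b] is [false]. *)
Definition cut (Q : quiver) (b : bool) (e : arrow Q) (X Y : set (vertex Q)) :=
  arrows_in X e /\ Y = X `&` half (~~ b) e.

Lemma arrows_in_end (Q : quiver) b (e : arrow Q) X :
  arrows_in X e -> X (arrow_end b e).
Proof. by case; case: b. Qed.

Section Moves.
Variables (Q : quiver) (hT : is_tree Q).
Implicit Types (a c d : connected_full_subquiver Q) (e f g h : arrow Q).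

(** A path inside the subquiver cannot use [g], which has an end outside. *)
Lemma sub_half_boundary a b g x :
  sub_vertices a (arrow_end (~~ b) g) -> ~ sub_vertices a (arrow_end b g) ->
  sub_vertices a x -> half (~~ b) g x.
Proof.
move=> ag nag ax; apply: linked_sub (sub_connected ag ax) => f af /= fg; subst f.
by apply: nag; apply: arrows_in_end.
Qed.

Lemma blocked_notin a b x : blocked b (sub_vertices a) x -> ~ sub_vertices a x.
Proof.
move=> [g [ag nag gx]] ax; apply: (half_disjoint hT gx).
exact: sub_half_boundary ax.
Qed.

Lemma cut_blocks a b e X x :
  cut b e X (sub_vertices a) -> half b e x -> blocked b (sub_vertices a) x.
Proof.
move=> [Xe ->] ex; exists e; split=> //.
  by split; [exact: arrows_in_end | exact: half_end].
by move=> [_]; apply: half_disjoint (half_end _ _).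
Qed.

(** Either [g] survives the cut as a border arrow, or it is cut off; then all of
    [half b g], and in particular [x], lies on the discarded side of [h], and
    [h] itself takes over the role of [g]. *)
Lemma cut_blocked a b h Y x :
  cut b h (sub_vertices a) Y ->
  blocked b (sub_vertices a) x -> blocked b Y x.
Proof.
move=> [ah ->] [g [ag nag gx]].
have [hg|hg] := half_total b h (arrow_end (~~ b) g) hT; last first.
  (* The inner end of [g] is kept, so [g] is still on the border. *)
  by exists g; split=> // -[].
have gh : g <> h by move=> gh; apply: nag; rewrite gh; apply: arrows_in_end.
(* The inner end of [g] is discarded: [h] becomes the blocking arrow. *)
exists h; split.
- by split; [exact: arrows_in_end | exact: half_end].
- by move=> [_]; apply: half_disjoint (half_end _ _).
- have ngh : ~ half b g (src h).
    move=> gsh; apply: (half_disjoint hT gsh).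
    by apply: sub_half_boundary ag nag _; case: ah.
  apply: rt_trans _ (half_linked_avoid ngh gx).
  exact: half_step gh (joinsC (arrow_ends_joins b g)) hg.
Qed.

(** The subquiver [a] grows to [c] through [h], so the outer end of [g] could be
    gained only if [g] were [h]; but [g] and [h] are oriented oppositely with
    respect to [a]. *)
Lemma uncut_blocked a c b h x :
  cut (~~ b) h (sub_vertices c) (sub_vertices a) ->
  blocked b (sub_vertices a) x -> blocked b (sub_vertices c) x.
Proof.
rewrite /cut negbK => -[ch ac] [g [ag nag gx]].
have [cg hg] : (sub_vertices c `&` half b h) (arrow_end (~~ b) g) by rewrite -ac.
exists g; split=> // cg'; apply: nag; rewrite ac; split=> //.
have [gh|gh] := pselect (g = h).
  by rewrite gh; apply: half_end.
exact: half_step gh (joinsC (arrow_ends_joins b g)) hg.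
Qed.

Definition move_by (be : bool * arrow Q) a c : Prop :=
  if be.1 then cut true be.2 (sub_vertices a) (sub_vertices c)
  else cut false be.2 (sub_vertices c) (sub_vertices a).

Lemma move_byP a c :
  reduction a c \/ enhancement a c <-> exists be, move_by be a c.
Proof.
split=> [[[e ae ce]|[e ce ae]]|[[[] e] [ae ce]]].
- by exists (true, e).
- by exists (false, e).
- by left; exists e.
- by right; exists e.
Qed.

Definition ge_sub : connected_full_subquiver Q -> connected_full_subquiver Q -> Prop :=
  clos_refl_trans _ (fun a c => reduction a c \/ enhancement a c).

(** Isolating the first move gives, for each step of a chain for [gt_sub], one
    arrow to work with; the other moves only have to preserve blocking. *)
Lemma gt_subP a d :
  gt_sub a d -> exists be c, move_by be a c /\ ge_sub c d.
Proof.
move=> ad; case: (clos_trans_t1n _ _ _ _ ad) =>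
  [c /move_byP[be mv]|c d' /move_byP[be mv] cd'].
  by exists be, c; split=> //; apply: rt_refl.
exists be, c; split=> //; apply: clos_t_clos_rt; exact: clos_t1n_trans.
Qed.

Lemma ge_sub_blocked_front a d x :
  ge_sub a d -> blocked true (sub_vertices a) x -> blocked true (sub_vertices d) x.
Proof.
elim=> [{}a {}d /move_byP[[[] e] mv]|//|b c e _ bc _ ce].
- exact: cut_blocked mv.
- exact: (uncut_blocked (b := true) mv).
- by move/bc/ce.
Qed.

Lemma ge_sub_blocked_behind a d x :
  ge_sub a d -> blocked false (sub_vertices d) x -> blocked false (sub_vertices a) x.
Proof.
elim=> [{}a {}d /move_byP[[[] e] mv]|//|b c e _ bc _ ce].
- exact: (uncut_blocked (b := false) mv).
- exact: cut_blocked mv.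
- by move/ce/bc.
Qed.

(** * Consecutive arrows pointing the same way on a walk *)

(** The arrows point the same way on a path through both, [e] coming first;
    equality is included, so that repeated arrows also count. *)
Definition faces e f : Prop := half true e (tgt f) /\ half false f (src e).

Lemma faces_refl e : faces e e.
Proof. by split; apply: rt_refl. Qed.

Lemma joins_inj (r : nat -> vertex Q) e i j :
  injective r -> joins e (r i) (r i.+1) -> joins e (r j) (r j.+1) -> i = j.
Proof.
by move=> ir [[s t]|[s t]] []; rewrite s t => -[/ir + /ir]; lia.
Qed.

Lemma ray_linked (r : nat -> vertex Q) e j m n :
  injective r -> (forall i, adjacent (r i) (r i.+1)) ->
  joins e (r j) (r j.+1) -> m <= n -> n <= j \/ j < m ->
  linked [set~ e] (r m) (r n).
Proof.
move=> ir ar ej; elim: n => [|n IH].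
  by rewrite leqn0 => /eqP-> _; apply: rt_refl.
rewrite leq_eqVlt => /orP[/eqP-> _|mn jmn]; first exact: rt_refl.
apply: rt_trans (IH _ _) _ => //; first by lia.
have [f fn] := ar n; apply: rt_step; exists f => //= fe; subst f.
have := joins_inj ir ej fn; lia.
Qed.

Lemma ray_faces (r : nat -> vertex Q) e f i j :
  injective r -> (forall k, adjacent (r k) (r k.+1)) -> i < j ->
  src e = r i -> tgt e = r i.+1 -> src f = r j -> tgt f = r j.+1 -> faces e f.
Proof.
move=> ir ar ij se te sf tf; rewrite /faces /half /= se te sf tf; split.
  by apply: ray_linked (ir) ar _ _ _; [left; split; eassumption | lia | lia].
apply: linked_sym.
by apply: ray_linked (ir) ar _ _ _; [left; split; eassumption | lia | lia].
Qed.

(** A ray indexed by the natural numbers is a journey, extended to negative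
    integers by arbitrary values. *)
Lemma ray_finite_inconsistent (r : nat -> vertex Q) :
  eventually_outward Q -> injective r -> (forall i, adjacent (r i) (r i.+1)) ->
  finite_set [set e | exists i, src e = r i.+1 /\ tgt e = r i].
Proof.
move=> hO ir ar.
have step (i : int) : i \in `[0, +oo[%R -> (i + 1)%R \in `[0, +oo[%R ->
    adjacent (r (absz i)) (r (absz (i + 1)%R)).
  rewrite !in_itv /= !andbT => i0 _.
  have -> : absz (i + 1)%R = (absz i).+1 by lia.
  exact: ar.
pose w := Walk step.
apply: sub_finite_set (hO w _ _).
- move=> e [i [se te]]; exists (Posz i); split=> //=.
  by rewrite se; congr r; lia.
- by exists 0%R => [|i]; rewrite /= in_itv /= ?andbT.
- move=> i j; rewrite /= !in_itv /= !andbT => i0 j0 /ir; lia.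
Qed.

(** Discarding the finitely many inconsistent arrows, any two arrows of the ray
    that are increasing in both time and position face each other. *)
Lemma ray_faces_pair (r : nat -> vertex Q) (S : set nat) (u : nat -> arrow Q)
    (p : nat -> nat) :
  eventually_outward Q -> injective r -> (forall i, adjacent (r i) (r i.+1)) ->
  infinite_set S -> (forall k, S k -> joins (u k) (r (p k)) (r (p k).+1)) ->
  exists m n, [/\ S m, S n, m < n & faces (u m) (u n)].
Proof.
move=> hO ir ar iS up; apply: contrapT => H.
have uI m n : S m -> S n -> m < n -> u m <> u n.
  by move=> Sm Sn mn umn; apply: H; exists m, n; split; rewrite ?umn //; apply: faces_refl.
(* The inconsistent arrows of the ray. *)
pose I := [set e | exists i, src e = r i.+1 /\ tgt e = r i].
pose S' := S `\` [set k | S k /\ I (u k)].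
have iS' : infinite_set S'.
  apply: infinite_setD => //; apply: contrapT => iSI; apply: H.
  have [|m [n [[Sm _] [Sn _] mn umn]]] :=
    infinite_pigeonhole (f := u) iSI (ray_finite_inconsistent hO ir ar).
    by move=> k [].
  by case: (uI m n).
have up' k : S' k -> src (u k) = r (p k) /\ tgt (u k) = r (p k).+1.
  move=> [Sk nI]; case: (up k Sk) => // -[sk tk].
  by case: nI; split=> //; exists (p k).
have uniq_p m n : S m -> S n -> m < n -> p m <> p n.
  move=> Sm Sn mn pmn; apply: (uI m n) => //.
  case: hT => uniqT _ _ _; apply: (uniqT _ _ _ _ (up m Sm)).
  by rewrite pmn; apply: up.
have [[m [n [[Sm _] [Sn _] mn pmn]]]|gt] := infinite_repeat_or_gt p iS'.
  by case: (uniq_p m n).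
have [m [S'm _ _]] := gt 0; have [n [S'n]] := gt (m + p m).
move=> mn pmn; apply: H; exists m, n; split; [by case: S'm|by case: S'n|lia|].
have [sm tm] := up' m S'm; have [sn tn] := up' n S'n.
by apply: (ray_faces ir ar _ sm tm sn tn); lia.
Qed.

(** The sign [s] chooses one of the two half-lines of the walk starting at [c].
    If no position is repeated, the positions are unbounded, so that the whole
    half-line is in the domain and forms a ray. *)
Lemma half_walk_faces_pair (w : walk Q) (c s : int) (S : set nat)
    (u : nat -> arrow Q) (p : nat -> nat) :
  eventually_outward Q -> injective_walk w -> (`|s| = 1)%R ->
  c \in walk_dom w -> infinite_set S ->
  (forall k, S k -> (c + s * (p k).+1%:Z)%R \in walk_dom w /\
     joins (u k) (walk_map w (c + s * (p k)%:Z)%R)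
                 (walk_map w (c + s * (p k).+1%:Z)%R)) ->
  exists m n, [/\ S m, S n, m < n & faces (u m) (u n)].
Proof.
move=> hO iw s1 cw iS up.
have [[m [n [Sm Sn mn pmn]]]|gt] := infinite_repeat_or_gt p iS.
  exists m, n; split=> //.
  have -> : u m = u n; last exact: faces_refl.
  case: hT => uniqT _ _ _; have [_ jm] := up m Sm; have [_ jn] := up n Sn.
  by apply: uniqT jm _; rewrite pmn.
have dom i : (c + s * i%:Z)%R \in walk_dom w.
  have [k [Sk _ ik]] := gt i; have [pk _] := up k Sk.
  have [sE|sE] : s = 1%R \/ s = (-1)%R by lia.
    by apply: itv_convex cw pk _; lia.
  by apply: itv_convex pk cw _; lia.
apply: (@ray_faces_pair (fun i => walk_map w (c + s * i%:Z)%R) S u p) => //.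
- move=> i j /iw; rewrite !dom => /(_ isT isT); nia.
- move=> i; have [sE|sE] : s = 1%R \/ s = (-1)%R by lia.
    have E : (c + s * i.+1%:Z = (c + s * i%:Z) + 1)%R by rewrite sE; lia.
    by rewrite E; apply: walk_step; rewrite -?E.
  have E : (c + s * i%:Z = (c + s * i.+1%:Z) + 1)%R by rewrite sE; lia.
  have [|e ej] := @walk_step _ w (c + s * i.+1%:Z)%R (dom _); first by rewrite -E.
  by exists e; rewrite E; apply: joinsC.
- by move=> k /up[].
Qed.

Lemma walk_faces_pair (w : walk Q) (S : set nat) (u : nat -> arrow Q) :
  eventually_outward Q -> injective_walk w -> infinite_set S ->
  (forall k, S k -> walk_arrows w (u k)) ->
  exists m n, [/\ S m, S n, m < n & faces (u m) (u n)].
Proof.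
move=> hO iw iS uw.
have /choice[i iP] k : exists i : int, S k -> [/\ i \in walk_dom w,
    (i + 1)%R \in walk_dom w & joins (u k) (walk_map w i) (walk_map w (i + 1)%R)].
  have [Sk|nSk] := pselect (S k); last by exists 0%R.
  by have [i iP] := uw k Sk; exists i.
have [k0 Sk0 _] := infinite_nat_gt 0 iS.
have [c0 _ _] := iP k0 Sk0; set c := i k0 in c0.
pose S1 := [set k | S k /\ (c <= i k)%R]; pose S2 := [set k | S k /\ (i k < c)%R].
(* One of the half-lines starting at [c] carries infinitely many arrows. *)
have [iS1|fS1] := pselect (infinite_set S1).
  have [||m [n [[Sm _] [Sn _] mn fmn]]] := @half_walk_faces_pair w c 1%R S1 u
    (fun k => absz (i k - c)%R) hO iw _ c0 iS1; last by exists m, n.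
  - by [].
  - move=> k [Sk ck]; have [_ i1 ij] := iP k Sk.
    have -> : (c + 1 * (absz (i k - c)).+1%:Z = i k + 1)%R by lia.
    by have -> : (c + 1 * (absz (i k - c))%:Z = i k)%R by lia.
have iS2 : infinite_set S2.
  move=> fS2; apply: iS; apply: (sub_finite_set (B := S1 `|` S2)).
    by move=> k Sk; case: (lerP c (i k)); [left | right].
  by rewrite finite_setU; split=> //; apply: contrapT.
have [||m [n [[Sm _] [Sn _] mn fmn]]] := @half_walk_faces_pair w c (-1)%R S2 u
  (* Going down from [c], the arrow between [i k] and [i k + 1] starts at the
     upper end, hence the predecessor. *)
  (fun k => (absz (c - i k)%R).-1) hO iw _ c0 iS2; last by exists m, n.
- by [].
- move=> k [Sk ck]; have [i0 _ ij] := iP k Sk.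
  have -> : (c + -1 * (absz (c - i k)).-1.+1%:Z = i k)%R by lia.
  have -> : (c + -1 * (absz (c - i k)).-1%:Z = i k + 1)%R by lia.
  by split=> //; apply: joinsC.
Qed.

Lemma faces_pair (S : set nat) (u : nat -> arrow Q) :
  eventually_outward Q -> finitely_branched Q -> infinite_set S ->
  exists m n, [/\ S m, S n, m < n & faces (u m) (u n)].
Proof.
move=> hO [N [w [iw _ wP]]] iS; have [K KP] := choice (fun k => wP (u k)).
have [y _ iF] := infinite_fiber (f := K) (B := setT) iS finite_finset (fun _ _ => I).
have [|m [n [[Sm _] [Sn _] mn fmn]]] := @walk_faces_pair (w y) _ u hO (iw y) iF.
  by move=> k [_ <-].
by exists m, n.
Qed.

(** * Well-foundedness *)

Lemma no_infinite_chain_gt_sub :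
  eventually_outward Q -> finitely_branched Q -> no_infinite_chain (@gt_sub Q).
Proof.
move=> hO hB [a aP].
have [be beP] := choice (fun k => gt_subP (aP k)).
have [c cP] := choice beP => {beP}.
have ge m n : m < n -> ge_sub (c m) (a n).
  elim: n => // n IH; rewrite ltnS leq_eqVlt => /orP[/eqP<-|mn].
    by case: (cP m).
  by apply: rt_trans (IH mn) _; apply: clos_t_clos_rt; exact: aP.
pose u k := (be k).2; pose S b := [set k | (be k).1 = b].
have [iS|fS] := pselect (infinite_set (S true)).
  (* The reduction at [u m] blocks [tgt (u n)], which the one at [u n] removes. *)
  have [m [n [Sm Sn mn [fmn _]]]] := faces_pair u hO hB iS.
  have [+ _] := cP m; have [+ _] := cP n; rewrite /move_by Sm Sn => -[an _] mvm.
  apply: (@blocked_notin (a n) true (tgt (u n))); last by case: an.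
  exact: ge_sub_blocked_front (ge _ _ mn) (cut_blocks mvm fmn).
have iS : infinite_set (S false).
  move=> fS'; apply: infinite_nat; apply: (sub_finite_set (B := S true `|` S false)).
    by move=> k _; rewrite /S /=; case: (be k).1; [left | right].
  by rewrite finite_setU; split=> //; apply: contrapT.
(* The enhancement at [u n] forces [src (u m)] to be blocked behind already in
   [c m], to which the enhancement at [u m] has just added it. *)
have [m [n [Sm Sn mn [_ fmn]]]] := faces_pair u hO hB iS.
have [+ _] := cP m; have [+ _] := cP n; rewrite /move_by Sm Sn => mvn -[am _].
apply: (@blocked_notin (c m) false (src (u m))); last by case: am.
exact: ge_sub_blocked_behind (ge _ _ mn) (cut_blocks mvn fmn).
Qed.

End Moves.

Theorem corollary3p1 (Q : quiver) (hT : is_tree Q) (hO : eventually_outward Q)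
    (hB : finitely_branched Q) :
  StrictOrder (@gt_sub Q) /\ no_infinite_chain (@gt_sub Q).
Proof.
have nic := no_infinite_chain_gt_sub hT hO hB.
split=> //; split; last by move=> a b c; apply: t_trans.
by move=> a aa; apply: nic; exists (fun=> a).
Qed.
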